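(* Let $R$ be a unital associative ring, $M$ a nonzero finitely generated left $R$-module, $\Omega = \mathbb{Z}^+$, $N = \bigoplus_{\alpha\in\Omega} M_\alpha$ with each $M_\alpha = M$, and $E = \mathrm{End}_R(N)$. Let $D\subseteq E$ be the diagonal subring and $T\subseteq E$ the subring of lower-triangular matrices. Then there exist $g,h\in E$ such that $T\subseteq gDh$. In particular, $D\approx T$.
   Context: $\mathbb{Z}^+$ is the set of positive integers. Endomorphisms are written on the right of their arguments, so $x(fg)=(xf)g$. Each $M_\alpha$ is identified with the corresponding summand of $N$. $D$ is the subring of all $f\in E$ such that $M_\alpha f\subseteq M_\alpha$ for each $\alpha\in\Omega$. $T$ is the subring of all $f\in E$ such that $M_\alpha f\subseteq\bigoplus_{\gamma\leq\alpha} M_\gamma$ for each $\alpha\in\Omega$. $gDh=\{gdh : d\in D\}$. For subrings $S_1,S_2\subseteq E$, $S_1\approx S_2$ means that there are finite subsets $U,U'\subseteq E$ such that $S_1\subseteq\langle S_2\cup U\rangle$ and $S_2\subseteq\langle S_1\cup U'\rangle$, where $\langle X\rangle$ is the subring generated by $X$. *)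

(* Defs.v *)
From HB Require Import structures.
From mathcomp Require Import all_boot all_order all_algebra.
From mathcomp Require Import all_classical.

Set Implicit Arguments.
Unset Strict Implicit.
Unset Printing Implicit Defensive.

Import GRing.Theory.
Local Open Scope ring_scope.
Local Open Scope classical_set_scope.

Definition posint : Type := {n : nat | (0 < n)%N}.
HB.instance Definition _ := Choice.on posint.

Definition finitely_generated (R : pzRingType) (M : lmodType R) : Prop :=
  exists (n : nat) (b : 'I_n -> M),
    forall m : M, exists c : 'I_n -> R, m = \sum_i c i *: b i.

Section DirectSum.
Variables (R : pzRingType) (I : choiceType) (M : lmodType R).

Definition finsupp : {pred I -> M} :=
  fun x => `[< finite_set [set i | x i != 0] >].

(* The external direct sum of copies of M indexed by I. *)
Record dsum := DSum { dsum_val :> I -> M; _ : dsum_val \in finsupp }.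

HB.instance Definition _ := [isSub for dsum_val].
HB.instance Definition _ := [Choice of dsum by <:].

Fact finsupp_submod_closed : submod_closed finsupp.
Proof.
split=> [|a x y].
  apply/asboolP; rewrite (_ : [set _ | _] = set0) //.
  by apply/seteqP; split=> i //=; rewrite eqxx.
move=> /asboolP xfin /asboolP yfin; apply/asboolP.
apply: (@sub_finite_set _ _ ([set i | x i != 0] `|` [set i | y i != 0])).
  move=> i /= axy; case: (eqVneq (x i) 0) => [xi0|]; last by left.
  right; move: axy; rewrite -[(a *: x + y) i]/(a *: x i + y i).
  by rewrite xi0 scaler0 add0r.
by rewrite finite_setU.
Qed.

HB.instance Definition _ :=
  GRing.isSubmodClosed.Build R (I -> M) finsupp finsupp_submod_closed.
HB.instance Definition _ := [SubChoice_isSubLmodule of dsum by <:].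

(* The submodule \bigoplus_(i in J) M_i of \bigoplus_i M_i: the families that
   vanish outside J.  The copy of M indexed by i is the case J = {i}. *)
Definition subsum (J : set I) : set dsum :=
  [set x : dsum | forall i, ~ J i -> x i = 0].

Definition summand (i : I) : set dsum := subsum [set i].

End DirectSum.

Section Endomorphisms.
Variables (R : pzRingType) (N : lmodType R).

Definition endo : Type := {linear N -> N}.

HB.instance Definition _ := gen_eqMixin endo.
HB.instance Definition _ := gen_choiceMixin endo.

Implicit Types f g h : endo.

Lemma endoP f g : f =1 g -> f = g.
Proof.
move=> fg; have : (f : N -> N) = g by apply/funext.
case: f g {fg} => [f [[f1] [f2]]] [g [[g1] [g2]]] /= E.
case: _ / E g1 g2 => g1 g2.
by rewrite (Prop_irrelevance f1 g1) (Prop_irrelevance f2 g2).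
Qed.

Definition endo0 : endo := \0.
Definition endo_opp f : endo := \- f.
Definition endo_add f g : endo := f \+ g.
Definition endo1 : endo := idfun.
(* Endomorphisms act on the right: x(fg) = (xf)g. *)
Definition endo_mul f g : endo := g \o f.

Fact endo_addA : associative endo_add.
Proof. by move=> f g h; apply: endoP => x /=; rewrite addrA. Qed.
Fact endo_addC : commutative endo_add.
Proof. by move=> f g; apply: endoP => x /=; rewrite addrC. Qed.
Fact endo_add0 : left_id endo0 endo_add.
Proof. by move=> f; apply: endoP => x /=; rewrite add0r. Qed.
Fact endo_addN : left_inverse endo0 endo_opp endo_add.
Proof. by move=> f; apply: endoP => x /=; rewrite addNr. Qed.
HB.instance Definition _ :=
  GRing.isZmodule.Build endo endo_addA endo_addC endo_add0 endo_addN.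

Fact endo_mulA : associative endo_mul.
Proof. by move=> f g h; apply: endoP. Qed.
Fact endo_mul1 : left_id endo1 endo_mul.
Proof. by move=> f; apply: endoP. Qed.
Fact endo_1mul : right_id endo1 endo_mul.
Proof. by move=> f; apply: endoP. Qed.
Fact endo_mulDl : left_distributive endo_mul +%R.
Proof. by move=> f g h; apply: endoP => x /=; rewrite raddfD. Qed.
Fact endo_mulDr : right_distributive endo_mul +%R.
Proof. by move=> f g h; apply: endoP. Qed.
HB.instance Definition _ := GRing.Zmodule_isPzRing.Build endo
  endo_mulA endo_mul1 endo_1mul endo_mulDl endo_mulDr.

End Endomorphisms.

Section Subrings.
Variable S : pzRingType.
Implicit Types A B : set S.

Definition subring_gen A : set S :=
  smallest (fun B => subring_closed [in B]) A.

Definition subring_sim A B : Prop :=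
  exists U V : set S,
    [/\ finite_set U, finite_set V,
        A `<=` subring_gen (B `|` U) & B `<=` subring_gen (A `|` V)].

End Subrings.

Section MatrixSubrings.
Variables (R : pzRingType) (M : lmodType R).

Notation N := (dsum posint M).

Definition diagonal_endos : set (endo N) :=
  [set f : endo N | forall i, f @` summand i `<=` summand i].

Definition lower_triangular_endos : set (endo N) :=
  [set f : endo N | forall i,
     f @` summand i `<=` subsum [set j | (val j <= val i)%N]].

End MatrixSubrings.

Arguments diagonal_endos {R} M.
Arguments lower_triangular_endos {R} M.

(* Main.v *)
From HB Require Import structures.
Require Import Defs.
From mathcomp Require Import all_boot all_order all_algebra.
From mathcomp Require Import all_classical.

Import GRing.Theory.
Local Open Scope ring_scope.
Local Open Scope classical_set_scope.

(** An endomorphism f in T is a lower-triangular matrix: its row i consists of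
    the finitely many entries f_ij with j <= i.  There are countably many
    positions (i, j), so all the entries can be listed along one diagonal: fix
    an injection c of pairs of positive integers into the positive integers,
    and let d be the diagonal endomorphism acting on the summand c (i, j) as
    f_ij.  Let g copy M_i into each of the summands c (i, j) with j <= i; this
    is an endomorphism because there are finitely many such j.  Let h carry
    the summand c (i, j) identically onto M_j.  Then an element m of M_i is
    sent by g d h to the sum over j <= i of (m f_ij) in M_j, which is m f;
    and neither g nor h depends on f.  Hence T is contained in g D h
    ([triangular_factorization]), and D is similar to T because D is contained
    in T while adjoining g and h to D generates at least T.

    Endomorphisms of the direct sum are built and compared through its
    universal property ([dsum_lift], [dsum_lift_inj], [dsum_ext]). *)

(** * The universal property of the direct sum *)

Section UniversalProperty.
Set Implicit Arguments.
Unset Strict Implicit.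
Variables (R : pzRingType) (I : choiceType) (M : lmodType R).
Local Notation N := (dsum I M).

Lemma dsum_eqP (x y : N) : x =1 y -> x = y.
Proof. by move=> xy; apply/val_inj/funext. Qed.

Lemma dsumD (x y : N) i : (x + y) i = x i + y i. Proof. by []. Qed.
Lemma dsumZ a (x : N) i : (a *: x) i = a *: x i. Proof. by []. Qed.

Lemma dsum_supp_finite (x : N) : finite_set [set i | x i != 0].
Proof. exact/asboolP/(valP x). Qed.

Fact dsum_inj_subproof i (m : M) :
  (fun j => if j == i then m else 0) \in @finsupp R I M.
Proof.
apply/asboolP; apply: (@sub_finite_set _ _ [set i]); last exact: finite_set1.
move=> j /=.
by case: ifP => [/eqP //|_]; rewrite eqxx.
Qed.

Definition dsum_inj i (m : M) : N := DSum (dsum_inj_subproof i m).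

Lemma dsum_injE i m j : dsum_inj i m j = if j == i then m else 0.
Proof. by []. Qed.

Fact dsum_inj_is_linear i : linear (dsum_inj i).
Proof.
move=> a x y; apply: dsum_eqP => j; rewrite dsumD dsumZ !dsum_injE.
by case: ifP => // _; rewrite scaler0 addr0.
Qed.
HB.instance Definition _ i :=
  GRing.isLinear.Build R M N _ (dsum_inj i) (dsum_inj_is_linear i).

Definition dsum_proj i (x : N) : M := x i.

Fact dsum_proj_is_linear i : linear (dsum_proj i).
Proof. by []. Qed.
HB.instance Definition _ i :=
  GRing.isLinear.Build R N M _ (dsum_proj i) (dsum_proj_is_linear i).

Lemma dsum_sum (J : Type) (r : seq J) (P : pred J) (F : J -> N) i :
  (\sum_(j <- r | P j) F j) i = \sum_(j <- r | P j) F j i.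
Proof. exact: (linear_sum (dsum_proj i)). Qed.

Lemma dsum_inj_summand i m : summand i (dsum_inj i m).
Proof. by move=> j /= /eqP/negPf ->. Qed.

Lemma summand_inj i (x : N) : summand i x -> x = dsum_inj i (x i).
Proof.
move=> xi; apply: dsum_eqP => j; rewrite dsum_injE.
by case: eqP => [->//|]; apply: xi.
Qed.

Section Lift.
Variables (V : lmodType R) (phi : I -> {linear M -> V}).

(** The sum over all of I is meaningful because its terms vanish outside the
    finite support of x; [dsum_lift_supp] reduces it to a finite sum over any
    finite set that contains this support, so that two arguments can share one
    index set. *)
Definition dsum_lift (x : N) : V := \sum_(i \in [set: I]) phi i (x i).

Lemma dsum_lift_supp (A : set I) (x : N) : finite_set A ->
  [set i | x i != 0] `<=` A -> dsum_lift x = \sum_(i \in A) phi i (x i).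
Proof.
move=> Afin xA; rewrite /dsum_lift; symmetry; apply: fsbig_widen => // i [_ /= nAi].
by case: (eqVneq (x i) 0) => [->|/xA//]; rewrite linear0.
Qed.

Fact dsum_lift_is_linear : linear dsum_lift.
Proof.
move=> a x y.
pose A := [set i | x i != 0] `|` [set i | y i != 0].
have Afin : finite_set A by rewrite finite_setU; split; apply: dsum_supp_finite.
rewrite (dsum_lift_supp (A := A) (x := x)) //; last by move=> i; left.
rewrite (dsum_lift_supp (A := A) (x := y)) //; last by move=> i; right.
rewrite (dsum_lift_supp (A := A)) //; last first.
  move=> i; rewrite /mkset dsumD dsumZ => axy.
  case: (eqVneq (x i) 0) => [xi0|]; last by left.
  by right; move: axy; rewrite xi0 scaler0 add0r.
rewrite !fsbig_finite // scaler_sumr -big_split.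
by apply: eq_bigr => i _; rewrite dsumD dsumZ linearP.
Qed.
HB.instance Definition _ :=
  GRing.isLinear.Build R N V _ dsum_lift dsum_lift_is_linear.

Lemma dsum_lift_inj i m : dsum_lift (dsum_inj i m) = phi i m.
Proof.
rewrite (dsum_lift_supp (A := [set i])) //; last first.
  by move=> j; rewrite /mkset dsum_injE; case: ifP => [/eqP //|_]; rewrite eqxx.
by rewrite fsbig_set1 dsum_injE eqxx.
Qed.

(** Both maps are determined by their values on the finitely many components
    of a given element, whence uniqueness in the universal property. *)
Lemma dsum_lift_unique (f : {linear N -> V}) :
  (forall i m, f (dsum_inj i m) = phi i m) -> f =1 dsum_lift.
Proof.
move=> fphi x.
have xfin := dsum_supp_finite x.
rewrite (dsum_lift_supp (A := [set i | x i != 0])) // fsbig_finite //=.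
under eq_bigr => i _ do rewrite -fphi.
rewrite -linear_sum; congr (f _); apply: dsum_eqP => j; rewrite dsum_sum.
case: (eqVneq (x j) 0) => [xj0|xj].
  by rewrite xj0 big1 // => i _; rewrite dsum_injE; case: eqP => // <-.
have js : j \in finmap.enum_fset (fset_set [set i | x i != 0]).
  by rewrite in_fset_set // inE.
rewrite (bigD1_seq j) ?finmap.fset_uniq //= eqxx big1 ?addr0 // => i ij.
by rewrite eq_sym (negPf ij).
Qed.

End Lift.

Lemma dsum_ext (V : lmodType R) (f f' : {linear N -> V}) :
  (forall i m, f (dsum_inj i m) = f' (dsum_inj i m)) -> f =1 f'.
Proof.
move=> ff' x; pose phi i : {linear M -> V} := f' \o dsum_inj i.
by rewrite (@dsum_lift_unique _ phi f) // (@dsum_lift_unique _ phi f').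
Qed.

End UniversalProperty.

(** * Subrings generated by a set *)

Section GeneratedSubring.
Variables (S : pzRingType) (A : set S).

Lemma sub_subring_gen : A `<=` subring_gen A.
Proof. by move=> x Ax B [_]; apply. Qed.

Lemma subring_genM x y :
  subring_gen A x -> subring_gen A y -> subring_gen A (x * y).
Proof.
move=> Ax Ay B genB; have [[_ _ BM] _] := genB.
have Bx : x \in B := mem_set (Ax B genB).
have By : y \in B := mem_set (Ay B genB).
exact/set_mem/BM.
Qed.

End GeneratedSubring.

(** * Listing the entries of a triangular matrix along a diagonal *)

Section Factorization.
Variables (R : pzRingType) (M : lmodType R).
Local Notation N := (dsum posint M).
Local Notation pos := {n : nat | (0 < n)%N}.

Definition pos_of (k : nat) : posint := exist _ k.+1 isT.

Definition pos_pair (i j : posint) : posint :=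
  pos_of (pickle ((i, j) : pos * pos)).

(* The default value is returned only outside the range of pos_pair. *)
Definition pos_unpair (k : posint) : posint * posint :=
  odflt (pos_of 0, pos_of 0) (unpickle (val k).-1 : option (pos * pos)).

Lemma pos_pairK i j : pos_unpair (pos_pair i j) = (i, j).
Proof. by rewrite /pos_unpair /pos_pair /= pickleK. Qed.

(** As k runs through 0, ..., i - 1, the index [pos_of k] runs through the
    columns j <= i of row i. *)
Definition spread_row (i : posint) (m : M) : N :=
  \sum_(k < val i) dsum_inj (pos_pair i (pos_of k)) m.

Fact spread_row_is_linear i : linear (spread_row i).
Proof.
move=> a x y; rewrite /spread_row scaler_sumr -big_split /=.
by apply: eq_bigr => k _; rewrite linearP.
Qed.
HB.instance Definition _ i :=
  GRing.isLinear.Build R M N _ (spread_row i) (spread_row_is_linear i).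

Definition spread : endo N := dsum_lift (fun i => spread_row i).

Definition gather : endo N :=
  dsum_lift (fun k => dsum_inj (pos_unpair k).2).

Definition entry (f : endo N) (i j : posint) : {linear M -> M} :=
  dsum_proj j \o f \o dsum_inj i.

Definition entries_diag (f : endo N) : endo N :=
  dsum_lift (fun k =>
    dsum_inj k \o entry f (pos_unpair k).1 (pos_unpair k).2).

(** [linear_sum] at endomorphisms of N: fixing the module structure of N here
    keeps rewriting from searching for it. *)
Lemma endo_sum (f : endo N) (n : nat) (F : 'I_n -> N) :
  f (\sum_k F k) = \sum_k f (F k).
Proof. exact: linear_sum. Qed.

Lemma spread_inj i m : spread (dsum_inj i m) = spread_row i m.
Proof. exact: dsum_lift_inj. Qed.

Lemma gather_inj k m : gather (dsum_inj k m) = dsum_inj (pos_unpair k).2 m.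
Proof. exact: dsum_lift_inj. Qed.

Lemma gather_pair i j m : gather (dsum_inj (pos_pair i j) m) = dsum_inj j m.
Proof. by rewrite gather_inj pos_pairK. Qed.

Lemma entries_diag_inj f k m :
  entries_diag f (dsum_inj k m) =
  dsum_inj k (entry f (pos_unpair k).1 (pos_unpair k).2 m).
Proof. exact: dsum_lift_inj. Qed.

Lemma entries_diag_pair f i j m :
  entries_diag f (dsum_inj (pos_pair i j) m) =
  dsum_inj (pos_pair i j) (entry f i j m).
Proof. by rewrite entries_diag_inj pos_pairK. Qed.

Lemma entries_diag_diagonal f : diagonal_endos M (entries_diag f).
Proof.
move=> k _ [x /summand_inj -> <-].
by rewrite entries_diag_inj; apply: dsum_inj_summand.
Qed.

Lemma triangular_row f i m : lower_triangular_endos M f ->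
  f (dsum_inj i m) = \sum_(k < val i) dsum_inj (pos_of k) (entry f i (pos_of k) m).
Proof.
move=> fT.
have row0 : subsum [set j | (val j <= val i)%N] (f (dsum_inj i m)).
  by apply: fT; exists (dsum_inj i m) => //; apply: dsum_inj_summand.
apply: dsum_eqP => j; rewrite dsum_sum.
have [ji|ij] := leqP (val j) (val i); last first.
  have -> : f (dsum_inj i m) j = 0 by apply: row0; apply/negP; rewrite -ltnNge.
  rewrite big1 // => k _; rewrite dsum_injE; case: eqP => // jk.
  by move: ij; rewrite jk ltnNge ltn_ord.
case: j ji => -[|n] //= n_gt0 ni.
have -> : exist (fun n => 0 < n)%N n.+1 n_gt0 = pos_of n by apply: val_inj.
rewrite (bigD1 (Ordinal ni)) //= eqxx big1 ?addr0 // => k kn.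
case: eqP => // -[nk].
by case/eqP: kn; apply: val_inj.
Qed.

(** On M_i, [spread] puts a copy of the argument at each listed position of
    row i, [entries_diag f] applies the entries, and [gather] returns the
    results to their columns; the triangular shape ensures that no entry of
    row i is missed. *)
Lemma triangular_factorization f : lower_triangular_endos M f ->
  spread * entries_diag f * gather = f.
Proof.
move=> fT; apply/endoP/dsum_ext => i m.
transitivity (gather (entries_diag f (spread_row i m))).
  by rewrite -spread_inj.
rewrite /spread_row !endo_sum triangular_row //.
by apply: eq_bigr => k _; rewrite entries_diag_pair gather_pair.
Qed.

Lemma diagonal_lower_triangular :
  diagonal_endos M `<=` lower_triangular_endos M.
Proof.
move=> f fD i y /fD yi j ji; apply: yi => /= ij.
by apply: ji; rewrite /= ij.
Qed.

End Factorization.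

Theorem proposition12 (R : pzRingType) (M : lmodType R)
    (M_fg : finitely_generated M) (M_neq0 : exists m : M, m != 0) :
  let E := endo (dsum posint M) in
  let D : set E := diagonal_endos M in
  let T : set E := lower_triangular_endos M in
  (exists g h : E, T `<=` [set g * d * h | d in D]) /\ subring_sim D T.
Proof.
move=> E D T; split.
  exists (spread M), (gather M) => f fT.
  exists (entries_diag f); first exact: entries_diag_diagonal.
  exact: triangular_factorization.
exists set0, [set spread M; gather M]; split.
- exact: finite_set0.
- by rewrite finite_setU; split; apply: finite_set1.
- rewrite setU0.
  exact: subset_trans (@diagonal_lower_triangular R M) (@sub_subring_gen _ _).
- move=> f /triangular_factorization <-.
  apply: subring_genM; first apply: subring_genM; apply: sub_subring_gen.
  + by right; left.
  + by left; apply: entries_diag_diagonal.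
  + by right; right.
Qed.
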